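(* Let $0\le m<n$ be integers and let $A\in\mathbb{R}^{n\times n}$ be symmetric with eigenvalues $\lambda_1(A),\dots,\lambda_n(A)$ and corresponding orthonormal eigenvectors $v_1(A),\dots,v_n(A)$. Consider the problem $$\min_X\ \|X-A\|_2\quad\text{subject to}\quad X\in\mathcal{L}_{m,n}.$$ For $\delta\ge 0$ let $I_k(\delta)=[\lambda_k(A)-\delta,\lambda_k(A)+\delta]$, and let $\delta^\star$ be the smallest real number $\delta\ge0$ such that at least $n-m$ of the intervals $I_1(\delta),\dots,I_n(\delta)$ have a common point. Let $X$ be a symmetric matrix with $v_k(X)=v_k(A)$ for all $k\in\{1,\dots,n\}$, and let $\lambda_k(X)$ be the eigenvalue of $X$ for the eigenvector $v_k(A)$. Then $X$ is an optimal solution of the problem if and only if both of the following hold: (1) $\lambda_k(X)\in I_k(\delta^\star)$ for all $k\in\{1,\dots,n\}$; (2) there is a set $K\subseteq\{1,\dots,n\}$ of $n-m$ indices such that the intervals $I_k(\delta^\star)$, $k\in K$, have a common point, and the $n-m$ eigenvalues $\lambda_k(X)$, $k\in K$, are all equal to one point lying in $\bigcap_{k\in K}I_k(\delta^\star)$.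
   Context: $\mathcal{L}_{m,n}$ denotes the set of real $n\times n$ matrices $M$ that can be written as $M=\alpha I+\sum_{i=1}^m a_iu_iu_i^T$ with $\alpha,a_i\in\mathbb{R}$ and $u_i\in\mathbb{R}^n$. $\|\cdot\|_2$ is the spectral norm (the operator norm induced by the Euclidean norm). The condition $v_k(X)=v_k(A)$ for all $k$ means that each $v_k(A)$ is an eigenvector of $X$. *)

(* Defs.v *)
From HB Require Import structures.
From mathcomp Require Import all_boot all_order all_algebra.
From mathcomp Require Import all_classical all_reals.

Set Implicit Arguments.
Unset Strict Implicit.
Unset Printing Implicit Defensive.

Import Order.TTheory GRing.Theory Num.Theory.

Local Open Scope classical_set_scope.
Local Open Scope ring_scope.

Definition dotv (R : realType) (n : nat) (x y : 'cV[R]_n) : R :=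
  \sum_(i < n) x i 0 * y i 0.

Definition norm2 (R : realType) (n : nat) (x : 'cV[R]_n) : R :=
  Num.sqrt (dotv x x).

(* The set is nonempty and bounded for every M, so sup never takes its
   default value. *)
Definition specnorm (R : realType) (n : nat) (M : 'M[R]_n) : R :=
  sup [set norm2 (M *m x) | x in [set x : 'cV[R]_n | norm2 x <= 1]].

Definition Lset (R : realType) (m n : nat) : set 'M[R]_n :=
  [set M | exists (alpha : R) (a : 'I_m -> R) (u : 'I_m -> 'cV[R]_n),
     M = alpha%:M + \sum_(i < m) a i *: (u i *m (u i)^T)].

Definition optimal (R : realType) (m n : nat) (A X : 'M[R]_n) : Prop :=
  @Lset R m n X /\
  forall Y, @Lset R m n Y -> specnorm (X - A) <= specnorm (Y - A).

Definition orthonormal_family (R : realType) (n : nat)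
    (v : 'I_n -> 'cV[R]_n) : Prop :=
  forall i j, dotv (v i) (v j) = (i == j)%:R.

Definition eigenpair (R : realType) (n : nat) (M : 'M[R]_n) (a : R)
    (v : 'cV[R]_n) : Prop :=
  v != 0 /\ M *m v = a *: v.

Definition Ival (R : realType) (n : nat) (lam : 'I_n -> R) (delta : R)
    (k : 'I_n) : set R :=
  [set` `[lam k - delta, lam k + delta]].

Definition common_points (R : realType) (n : nat) (lam : 'I_n -> R)
    (delta : R) (K : {set 'I_n}) : set R :=
  \bigcap_(k in [set` K]) Ival lam delta k.

Definition admissible (R : realType) (m n : nat) (lam : 'I_n -> R) : set R :=
  [set delta | 0 <= delta /\
     exists K : {set 'I_n}, (n - m <= #|K|)%N /\
       common_points lam delta K !=set0].

Definition smallest_admissible (R : realType) (m n : nat) (lam : 'I_n -> R)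
    (delta : R) : Prop :=
  admissible m lam delta /\ lbound (admissible m lam) delta.

(* Main.v *)
(* Let Y = alpha I + sum_i a_i u_i u_i^T have m rank-one terms, and suppose that
   more than m eigenvalues of A lie at distance > ||Y - A|| from alpha. Counting
   dimensions, the span of their eigenvectors contains a nonzero x orthogonal to
   all u_i. Then Y x = alpha x, so |(Y - A) x| > ||Y - A|| |x|, which is absurd.
   Hence at least n - m of the intervals of radius ||Y - A|| contain alpha, so
   ||Y - A|| >= delta*. Conversely, moving n - m eigenvalues of A to a common
   point of their intervals gives a feasible matrix at distance at most delta*.
   So X is optimal iff it is feasible and ||X - A|| <= delta*. As X and A are
   simultaneously diagonal, the norm bound is condition (1); and the argument
   above, applied to X in place of both Y and A, shows that feasibility makes
   n - m eigenvalues of X coincide. *)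

Require Import Defs.
From mathcomp Require Import all_boot all_order all_algebra.
From mathcomp Require Import all_classical all_reals.
From mathcomp Require Import ring lra.

Import Order.TTheory GRing.Theory Num.Theory.

Local Open Scope classical_set_scope.
Local Open Scope ring_scope.

(** * Euclidean inner product and spectral norm *)

Lemma dotvE {R : realType} {n : nat} (x y : 'cV[R]_n) :
  dotv x y = (x^T *m y) 0 0.
Proof. by rewrite mxE; apply: eq_bigr => i _; rewrite mxE. Qed.

Lemma dotv_ge0 {R : realType} {n : nat} (x : 'cV[R]_n) : 0 <= dotv x x.
Proof. by apply: sumr_ge0 => i _; rewrite -expr2 sqr_ge0. Qed.

Lemma dotv_eq0 {R : realType} {n : nat} (x : 'cV[R]_n) :
  (dotv x x == 0) = (x == 0).
Proof.
apply/eqP/eqP => [/eqP|->]; last by rewrite /dotv big1 // => i _; rewrite mxE mul0r.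
rewrite psumr_eq0 => [/allP h|i _]; last by rewrite -expr2 sqr_ge0.
apply/colP => i; rewrite mxE; apply/eqP.
by have := h i (mem_index_enum i); rewrite mulf_eq0 orbb.
Qed.

Lemma norm2_0 {R : realType} {n : nat} : norm2 (0 : 'cV[R]_n) = 0.
Proof. by rewrite /norm2 (eqP (_ : dotv 0 0 == 0)) ?sqrtr0 // dotv_eq0. Qed.

Lemma dotvZZ {R : realType} {n : nat} (c : R) (x : 'cV[R]_n) :
  dotv (c *: x) (c *: x) = c ^+ 2 * dotv x x.
Proof. by rewrite /dotv mulr_sumr; apply: eq_bigr => i _; rewrite !mxE; ring. Qed.

Lemma norm2_le {R : realType} {n : nat} {x : 'cV[R]_n} {e : R} :
  0 <= e -> (norm2 x <= e) = (dotv x x <= e ^+ 2).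
Proof.
by move=> e0; rewrite -[RHS]ler_sqrt ?sqr_ge0 // sqrtr_sqr ger0_norm.
Qed.

(** A crude bound suffices: coordinates of a vector in the unit ball are at most 1 in absolute
    value, so each coordinate of [M *m x] is bounded by an absolute row sum of [M]. *)
Lemma specnorm_has_sup {R : realType} {n : nat} (M : 'M[R]_n) :
  has_sup [set norm2 (M *m x) | x in [set x : 'cV[R]_n | norm2 x <= 1]].
Proof.
split; first by exists (norm2 (M *m 0)); exists 0 => //=; rewrite norm2_0 ler01.
exists (Num.sqrt (\sum_i (\sum_j `|M i j|) ^+ 2)) => _ [x /= hx <-].
rewrite ler_wsqrtr //; apply: ler_sum => i _.
rewrite -expr2 -(real_normK (num_real ((M *m x) i 0))) lerXn2r ?nnegrE //.
  by apply: sumr_ge0.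
rewrite mxE; apply: le_trans (ler_norm_sum _ _ _) _; apply: ler_sum => j _.
rewrite normrM ler_piMr // -(@ler_pXn2r _ 2) ?nnegrE // real_normK ?num_real //.
move: hx; rewrite norm2_le //; apply: le_trans.
rewrite /dotv (bigD1 j) //= -expr2 lerDl; apply: sumr_ge0 => k _.
by rewrite -expr2 sqr_ge0.
Qed.

Lemma specnorm_ge0 {R : realType} {n : nat} (M : 'M[R]_n) : 0 <= specnorm M.
Proof.
have [_ h2] := specnorm_has_sup M.
apply: ub_le_sup => //; exists 0; first by rewrite /= norm2_0 ler01.
by rewrite mulmx0 norm2_0.
Qed.

Lemma specnorm_leP {R : realType} {n : nat} {M : 'M[R]_n} {e : R} :
  0 <= e ->
  specnorm M <= e <->
  forall x : 'cV[R]_n, dotv (M *m x) (M *m x) <= e ^+ 2 * dotv x x.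
Proof.
move=> e0; have [h1 h2] := specnorm_has_sup M; split=> [he x|he]; last first.
  apply: ge_sup => // _ [x /= hx <-]; rewrite norm2_le //.
  apply: le_trans (he x) _; rewrite ler_piMr ?sqr_ge0 //.
  by move: hx; rewrite norm2_le // expr1n.
have [->|x0] := eqVneq x 0.
  by rewrite mulmx0 (eqP (_ : dotv 0 0 == 0)) ?dotv_eq0 // mulr0.
have d0 : 0 < dotv x x by rewrite lt_def dotv_eq0 x0 dotv_ge0.
(* The supremum only sees the unit ball, so [x] is rescaled to length 1. *)
pose t := (norm2 x)^-1.
have t2 : t ^+ 2 = (dotv x x)^-1 by rewrite exprVn sqr_sqrtr // ltW.
have : norm2 (M *m (t *: x)) <= e.
  apply: le_trans he; apply: ub_le_sup => //; exists (t *: x) => //=.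
  by rewrite norm2_le // dotvZZ t2 mulVf ?expr1n ?gt_eqF.
by rewrite norm2_le // -scalemxAr dotvZZ t2 mulrC ler_pdivrMr.
Qed.

(** * Orthonormal eigenbases *)

Lemma orthonormal_resolution {R : realType} {n : nat} {v : 'I_n -> 'cV[R]_n} :
  orthonormal_family v -> \sum_k v k *m (v k)^T = 1%:M.
Proof.
move=> hv; pose V := \matrix_(i, j) v j i 0 : 'M[R]_n.
have hV : V^T *m V = 1%:M.
  apply/matrixP => i j; rewrite !mxE -hv.
  by apply: eq_bigr => k _; rewrite !mxE.
(* A left inverse of a square matrix is also a right inverse, and the sum is [V *m V^T]. *)
rewrite -(mulmx1C hV); apply/matrixP => i j; rewrite summxE mxE.
by apply: eq_bigr => k _; rewrite !mxE big_ord1 !mxE.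
Qed.

Lemma orthonormal_parseval {R : realType} {n : nat} {v : 'I_n -> 'cV[R]_n}
    (x : 'cV[R]_n) :
  orthonormal_family v -> dotv x x = \sum_k dotv (v k) x ^+ 2.
Proof.
move=> hv; rewrite dotvE -[x in _ *m x]mul1mx -(orthonormal_resolution hv).
rewrite mulmx_suml mulmx_sumr summxE; apply: eq_bigr => k _.
rewrite mulmxA mulmxA -mulmxA mxE big_ord1 -!dotvE expr2; congr (_ * _).
by apply: eq_bigr => i _; rewrite mulrC.
Qed.

Lemma dotv_eigen {R : realType} {n : nat} {M : 'M[R]_n} {mu : R}
    {w : 'cV[R]_n} (x : 'cV[R]_n) :
  M^T = M -> M *m w = mu *: w -> dotv w (M *m x) = mu * dotv w x.
Proof.
move=> hM hw; rewrite !dotvE mulmxA -{1}hM -trmx_mul hw linearZ /= -scalemxAl.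
by rewrite mxE.
Qed.

(** Testing on [v k] gives one direction; for the other, [M] scales each coordinate in the
    eigenbasis, and Parseval compares the squared norms term by term. *)
Lemma specnorm_eigen_leP {R : realType} {n : nat} {v : 'I_n -> 'cV[R]_n}
    {M : 'M[R]_n} {mu : 'I_n -> R} {e : R} :
  orthonormal_family v -> M^T = M -> (forall k, M *m v k = mu k *: v k) ->
  0 <= e -> specnorm M <= e <-> forall k, `|mu k| <= e.
Proof.
move=> hv hM hmu e0; apply: iff_trans (specnorm_leP e0) _; split=> h.
  move=> k; have := h (v k); rewrite hmu dotvZZ hv eqxx !mulr1 => hk.
  by rewrite -(@ler_pXn2r _ 2) ?nnegrE // real_normK ?num_real.
move=> x; rewrite !(orthonormal_parseval _ hv) mulr_sumr; apply: ler_sum => k _.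
rewrite (dotv_eigen _ hM (hmu k)) exprMn ler_wpM2r ?sqr_ge0 //.
by rewrite -(real_normK (num_real (mu k))) lerXn2r ?nnegrE.
Qed.

(** * Scalar matrices plus [m] rank-one terms *)

Lemma exists_orthogonal_vector {R : realType} {m n : nat}
    (v : 'I_n -> 'cV[R]_n) (u : 'I_m -> 'cV[R]_n) {P : {set 'I_n}} :
  (m < #|P|)%N ->
  exists2 x : 'cV[R]_n, x != 0 &
    (forall k, k \notin P -> dotv (v k) x = 0) /\ (forall i, dotv (u i) x = 0).
Proof.
move=> hP; have hPn := max_card (mem P); rewrite card_ord in hPn.
(* The rows of [B] are the required orthogonality equations, [n - #|P| + m < n] in number. As
   [kermx] is a left kernel, [B] is transposed. *)
pose B := col_mx (\matrix_(i < #|~: P|, j < n) v (enum_val i) j 0)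
                 (\matrix_(i < m, j < n) u i j 0).
have hB : (\rank (B^T) < n)%N.
  apply: leq_ltn_trans (rank_leq_col _) _.
  by rewrite cardsCs finset.setCK card_ord -ltn_subRL subKn.
have : kermx B^T != 0 by rewrite -mxrank_eq0 mxrank_ker subn_eq0 -ltnNge.
case/rowV0Pn => y /sub_kermxP hy y0; exists (y^T); first by rewrite -trmx0 (inj_eq trmx_inj).
have {hy} hy : B *m y^T = 0 by rewrite -[B]trmxK -trmx_mul hy trmx0.
move: hy; rewrite mul_col_mx -col_mx0 => /eq_col_mx [h1 h2].
split=> [k kP|i].
  have kP' : k \in ~: P by rewrite inE.
  move/colP/(_ (enum_rank_in kP' k)): h1; rewrite !mxE => <-.
  by apply: eq_bigr => j _; rewrite !mxE enum_rankK_in.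
move/colP/(_ i): h2; rewrite !mxE => <-.
by apply: eq_bigr => j _; rewrite !mxE.
Qed.

(** The scalar part of [Y] serves as [alpha]. The case [Y = A] is also of use: the radius is then 0,
    and eigenvalues coincide. *)
Lemma Lset_eigen_close {R : realType} {m n : nat} {v : 'I_n -> 'cV[R]_n}
    {A Y : 'M[R]_n} {lam : 'I_n -> R} :
  orthonormal_family v -> A^T = A -> (forall k, A *m v k = lam k *: v k) ->
  Lset m Y ->
  exists alpha : R,
    (n - m <= #|[set k | (`|alpha - lam k| <= specnorm (Y - A))%R]%SET|)%N.
Proof.
move=> hv hA hlam [alpha [a [u hY]]]; exists alpha.
set K := [set k | _]%SET; rewrite leqNgt; apply/negP => hK.
have hP : (m < #|~: K|)%N.
  by rewrite cardsCs finset.setCK card_ord ltn_subRL addnC -ltn_subRL.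
have [x x0 [hx hu]] := exists_orthogonal_vector v u hP.
have hYx : Y *m x = alpha *: x.
  rewrite hY mulmxDl mul_scalar_mx mulmx_suml big1 ?addr0 // => i _.
  rewrite -scalemxAl -mulmxA (_ : (u i)^T *m x = 0) ?mulmx0 ?scaler0 //.
  by apply/matrixP => r s; rewrite !ord1 -dotvE hu mxE.
have /specnorm_leP/(_ x) := lexx (specnorm (Y - A)).
move=> /(_ (specnorm_ge0 _)); rewrite leNgt => /negP; apply.
rewrite !(orthonormal_parseval _ hv) mulr_sumr mulmxBl hYx.
have hk k : dotv (v k) (alpha *: x - A *m x) = (alpha - lam k) * dotv (v k) x.
  rewrite -mul_scalar_mx -mulmxBl; apply: dotv_eigen.
    by rewrite linearB /= tr_scalar_mx hA.
  by rewrite mulmxBl mul_scalar_mx hlam scalerBl.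
have hlt k : k \in ~: K -> specnorm (Y - A) ^+ 2 < (alpha - lam k) ^+ 2.
  rewrite !inE -ltNge => hk'; rewrite -(real_normK (num_real (alpha - lam k))).
  by rewrite ltr_pXn2r ?nnegrE // specnorm_ge0.
(* One nonzero coordinate makes the inequality between the sums strict; its index lies outside [K],
   since the coordinates of [x] in [K] vanish. *)
have [k0 hk0] : exists k, dotv (v k) x != 0.
  apply/existsP; rewrite -[X in is_true X]negbK negb_exists; apply/negP => /forallP h.
  move/negP: x0; apply; rewrite -dotv_eq0 (orthonormal_parseval _ hv).
  by rewrite big1 // => k _; have := h k; rewrite negbK => /eqP ->; rewrite expr0n.
have hle k : specnorm (Y - A) ^+ 2 * dotv (v k) x ^+ 2
    <= dotv (v k) (alpha *: x - A *m x) ^+ 2.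
  rewrite hk exprMn; have [kP|/hx->] := boolP (k \in ~: K).
    by rewrite ler_wpM2r ?sqr_ge0 // ltW // hlt.
  by rewrite expr0n !mulr0.
rewrite (bigD1 k0) //= [ltRHS](bigD1 k0) //=; apply: ltr_leD; last exact: ler_sum.
rewrite hk exprMn ltr_pM2r; last by rewrite exprn_even_gt0.
by apply: hlt; apply: contraNT hk0 => /hx ->.
Qed.

Lemma Lset_of_eigen {R : realType} {m n : nat} {v : 'I_n -> 'cV[R]_n}
    {M : 'M[R]_n} {mu : 'I_n -> R} {c : R} {K : {set 'I_n}} :
  (m < n)%N -> orthonormal_family v -> (forall k, M *m v k = mu k *: v k) ->
  (n - m <= #|K|)%N -> (forall k, k \in K -> mu k = c) -> Lset m M.
Proof.
move=> mn hv hmu hK hc; have k0 : 'I_n := Ordinal mn.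
pose s := enum (~: K).
have hs : (size s <= m)%N.
  by rewrite -cardE cardsCs finset.setCK card_ord leq_subLR addnC -leq_subLR.
(* Zero coefficients pad the at most [m] terms outside [K] to exactly [m], so the default [k0] of
   [nth] has no effect. *)
exists c, (fun i : 'I_m => if (i < size s)%N then mu (nth k0 s i) - c else 0).
exists (fun i : 'I_m => v (nth k0 s i)).
have -> : M = \sum_k mu k *: (v k *m (v k)^T).
  rewrite -[LHS]mulmx1 -(orthonormal_resolution hv) mulmx_sumr.
  by apply: eq_bigr => k _; rewrite mulmxA hmu scalemxAl.
transitivity (c%:M + \sum_(k in ~: K) (mu k - c) *: (v k *m (v k)^T)).
  rewrite -scalemx1 -(orthonormal_resolution hv) scaler_sumr.
  rewrite [X in _ = _ + X]big_mkcond -big_split /=; apply: eq_bigr => k _.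
  rewrite inE; case: ifPn => [_|/negbNE/hc->]; last by rewrite addr0.
  by rewrite -scalerDl addrC subrK.
congr (_ + _); rewrite -big_enum /= (big_nth k0) big_mkord -/s.
rewrite (big_ord_widen m (fun i : nat => (mu (nth k0 s i) - c) *:
  (v (nth k0 s i) *m (v (nth k0 s i))^T))) // big_mkcond.
by apply: eq_bigr => i _; case: ifP => // _; rewrite scale0r.
Qed.

(** * Admissible radii *)

Lemma IvalE {R : realType} {n : nat} {lam : 'I_n -> R} {delta : R} {k : 'I_n}
    {c : R} :
  Ival lam delta k c <-> `|c - lam k| <= delta.
Proof. by rewrite /Ival /= in_itv /= ler_distl. Qed.

(** Intervals of equal radius meet as soon as the radius reaches half the spread of their centres.
    Hence every admissible radius can be lowered to one of the finitely many values [r p], among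
    which a minimum exists. *)
Lemma smallest_admissible_exists {R : realType} {m n : nat} (lam : 'I_n -> R) :
  (m < n)%N -> exists delta, smallest_admissible m lam delta.
Proof.
move=> mn; have k0 : 'I_n := Ordinal mn.
pose r (p : 'I_n * 'I_n) := `|lam p.1 - lam p.2| / 2.
have red delta : admissible m lam delta ->
    exists p, admissible m lam (r p) /\ r p <= delta.
  move=> [d0 [K [hK [c hc]]]].
  have [k hk] : exists k, k \in K.
    by apply/set0Pn; rewrite -card_gt0 (leq_trans _ hK) // subn_gt0.
  case: (arg_minP lam hk) => i iK hi; case: (arg_maxP lam hk) => j jK hj.
  have ij : lam i <= lam j by apply: le_trans (hi _ hk) (hj _ hk).
  have rE : r (j, i) = (lam j - lam i) / 2 by rewrite /r /= ger0_norm // subr_ge0.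
  exists (j, i); split; last first.
    have /IvalE := hc i iK; have /IvalE := hc j jK.
    by rewrite rE !ler_distl => /andP[h1 _] /andP[_ h2]; lra.
  split; first by rewrite divr_ge0.
  (* The midpoint of the extreme centres is a common point. *)
  exists K; split=> //; exists ((lam i + lam j) / 2) => l /= lK; apply/IvalE.
  rewrite rE ler_distl; have := hi l lK; have := hj l lK => /= h1 h2.
  by apply/andP; split; lra.
(* At this radius all intervals contain 0, so the finite minimum is over a nonempty set. *)
have adm : admissible m lam (\sum_k `|lam k|).
  split; first exact: sumr_ge0.
  exists [set: 'I_n]%SET; split; first by rewrite cardsT card_ord leq_subr.
  exists 0 => k _; apply/IvalE; rewrite sub0r normrN (bigD1 k) //= lerDl.
  exact: sumr_ge0.
have [p [hp _]] := red _ adm.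
have hp' : `[< admissible m lam (r p) >] by apply/asboolP.
case: (arg_minP (P := fun q => `[< admissible m lam (r q) >]) r hp') => q /asboolP hq hmin.
exists (r q); split=> // delta /red [p' [/asboolP h1 h2]].
exact: le_trans (hmin _ h1) h2.
Qed.

Lemma Lset_specnorm_admissible {R : realType} {m n : nat}
    {v : 'I_n -> 'cV[R]_n} {A Y : 'M[R]_n} {lam : 'I_n -> R} :
  orthonormal_family v -> A^T = A -> (forall k, A *m v k = lam k *: v k) ->
  Lset m Y -> admissible m lam (specnorm (Y - A)).
Proof.
move=> hv hA hlam /(Lset_eigen_close hv hA hlam) [alpha hK].
split; first exact: specnorm_ge0.
by eexists; split; first exact: hK; exists alpha => k /=; rewrite inE => /IvalE.
Qed.

Lemma admissible_attained {R : realType} {m n : nat} {v : 'I_n -> 'cV[R]_n}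
    {A : 'M[R]_n} {lam : 'I_n -> R} {delta : R} :
  (m < n)%N -> orthonormal_family v -> A^T = A ->
  (forall k, A *m v k = lam k *: v k) -> admissible m lam delta ->
  exists2 Y, Lset m Y & specnorm (Y - A) <= delta.
Proof.
move=> mn hv hA hlam [d0 [K [hK [c hc]]]].
(* Only eigenvalues with index in [K] are moved, so [Y - A] has eigenvalues [c - lam k] on [K] and 0
   elsewhere. *)
pose mu k := if k \in K then c else lam k.
pose Y := \sum_k mu k *: (v k *m (v k)^T).
have hY k : Y *m v k = mu k *: v k.
  rewrite mulmx_suml (bigD1 k) //= big1 ?addr0 => [|j jk].
    rewrite -scalemxAl -mulmxA (_ : _ *m v k = 1%:M) ?mulmx1 //.
    by apply/matrixP => r s; rewrite !ord1 -dotvE hv eqxx !mxE.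
  rewrite -scalemxAl -mulmxA (_ : _ *m v k = 0) ?mulmx0 ?scaler0 //.
  by apply/matrixP => r s; rewrite !ord1 -dotvE hv (negbTE jk) !mxE.
exists Y.
  by apply: (Lset_of_eigen (c := c) mn hv hY hK) => k kK; rewrite /mu kK.
apply/(specnorm_eigen_leP (mu := fun k => mu k - lam k) hv) => // [|k|k].
- rewrite linearB /= hA; congr (_ - _); rewrite linear_sum; apply: eq_bigr => k _.
  by rewrite linearZ /= trmx_mul trmxK.
- by rewrite mulmxBl hY hlam scalerBl.
- by rewrite /mu; case: ifP => kK; [apply/IvalE; apply: hc|rewrite subrr normr0].
Qed.

(** * Characterization of the optimal solutions *)

Theorem theorem3 (R : realType) (m n : nat) (hmn : (m < n)%N)
    (A : 'M[R]_n) (hA : A^T = A)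
    (lamA : 'I_n -> R) (v : 'I_n -> 'cV[R]_n)
    (hv : orthonormal_family v)
    (hlamA : forall k, eigenpair A (lamA k) (v k)) :
  (exists delta : R, smallest_admissible m lamA delta) /\
  forall delta : R, smallest_admissible m lamA delta ->
  forall (X : 'M[R]_n) (lamX : 'I_n -> R),
    X^T = X ->
    (forall k, eigenpair X (lamX k) (v k)) ->
    (optimal m A X <->
      (forall k, Ival lamA delta k (lamX k)) /\
      (exists K : {set 'I_n},
         [/\ #|K| = (n - m)%N,
             common_points lamA delta K !=set0 &
             exists2 c : R, common_points lamA delta K c &
               forall k, k \in K -> lamX k = c])).
Proof.
split; first exact: smallest_admissible_exists.
move=> delta [hadm hlb] X lamX hX hlamX.
have eA k : A *m v k = lamA k *: v k by have [] := hlamA k.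
have eX k : X *m v k = lamX k *: v k by have [] := hlamX k.
have d0 : 0 <= delta by case: hadm.
have hdist : specnorm (X - A) <= delta <-> forall k, Ival lamA delta k (lamX k).
  apply: iff_trans (specnorm_eigen_leP (mu := fun k => lamX k - lamA k) hv _ _ d0) _.
  - by rewrite linearB /= hA hX.
  - by move=> k; rewrite mulmxBl eX eA scalerBl.
  - by split=> h k; apply/IvalE; apply: h.
split=> [[XL Xmin]|[/hdist Xd [K [hK _ [c _ hc]]]]]; last first.
  (* Sufficiency: (2) gives feasibility, and [delta] bounds the distance of every feasible matrix
     from below. *)
  split; first by apply: (Lset_of_eigen (c := c) hmn hv eX _ hc); rewrite hK.
  move=> Y /(Lset_specnorm_admissible hv hA eA) /hlb; exact: le_trans.
have [Y YL Yd] := admissible_attained hmn hv hA eA hadm.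
have /hdist hI : specnorm (X - A) <= delta := le_trans (Xmin _ YL) Yd.
(* [X] is compared with itself: at radius 0, at least [n - m] of its eigenvalues equal [c]. *)
split=> //; have [c] := Lset_eigen_close hv hX eX XL.
have -> : specnorm (X - X) = 0.
  apply/le_anti; rewrite specnorm_ge0 andbT; apply/specnorm_leP => // x.
  by rewrite subrr mul0mx expr0n mul0r le_eqVlt dotv_eq0 eqxx.
set K' := [set k | _]%SET => hK'.
have hc k : k \in K' -> lamX k = c.
  by rewrite inE normr_le0 subr_eq0 => /eqP.
(* [K'] may be too large, while (2) asks for exactly [n - m] indices. *)
have [K KK' hK] : exists2 K : {set 'I_n}, K \subset K' & #|K| = (n - m)%N.
  have /card_geqP [s [us hs sK]] := hK'.
  exists [set k in s]%SET; first by apply/fintype.subsetP => k; rewrite inE => /sK.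
  by rewrite cardsE -hs; apply/card_uniqP.
(* On [K], [c] is the eigenvalue [lamX k], which (1) places in the interval of index [k]. *)
have hcK : common_points lamA delta K c.
  by move=> k /= /(fintype.subsetP KK') /hc <-; apply: hI.
exists K; split=> //; first by exists c.
by exists c => // k /(fintype.subsetP KK') /hc.
Qed.
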